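(* Let $r\ge2$ and $s\ge2$ be integers, and let $H$ be an $r$-uniform hypergraph with $s(H)=s$. Then for all $n\ge|V(H)|$, \[\mathrm{wsat}(n,H)\ge\gamma_{s,H}\left(\binom{n}{s-1}-|\partial_{s-1}(H)|\right)+|E(H)|-1.\]
   Context: An $r$-uniform hypergraph $H$ has finite vertex set $V(H)$ and edge set $E(H)\subseteq\binom{V(H)}{r}$. $K_n^r$ is the complete $r$-uniform hypergraph on $n$ vertices. For non-empty $H$, $F$ on $n$ vertices is weakly $H$-saturated if the edges of $E(K_n^r)\setminus E(F)$ can be ordered $e_1,\dots,e_k$ so that each $F\cup\{e_1,\dots,e_i\}$ contains a copy of $H$ containing $e_i$; $\mathrm{wsat}(n,H)$ is the minimum number of edges of such $F$. The sparseness $s(H)$ of non-empty $H$ is the size of a smallest $S\subseteq V(H)$ contained in exactly one edge of $H$. For $m\ge1$, the $m$-shadow $\partial_m(G)$ is the set of $m$-element sets contained in some edge of $G$. Define \[\gamma_{s,H}=\min\left\{\frac{|E(H)|-|E(G)|-1}{|\partial_{s-1}(H)|-|\partial_{s-1}(G)|}: G\subseteq H,\ E(G)\neq\emptyset,\ |\partial_{s-1}(G)|<|\partial_{s-1}(H)|\right\},\] where $G\subseteq H$ means $E(G)\subseteq E(H)$. *)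

(* Defs.v *)
From mathcomp Require Import all_boot all_order all_algebra.
From mathcomp Require Import zify.

Set Implicit Arguments.
Unset Strict Implicit.
Unset Printing Implicit Defensive.

Import Order.TTheory GRing.Theory Num.Theory.

(* A hypergraph with vertex set V is its edge set H : {set {set V}}; vertices
   in no edge are allowed, and |V(H)| is #|V|. *)
Definition uniform (V : finType) (r : nat) (H : {set {set V}}) : bool :=
  [forall e in H, #|e| == r].

Definition complete (V : finType) (r : nat) : {set {set V}} :=
  [set e : {set V} | #|e| == r].

Definition shadow (V : finType) (m : nat) (G : {set {set V}}) : {set {set V}} :=
  [set S : {set V} | (#|S| == m) && [exists e in G, S \subset e]].

Definition in_one_edge (V : finType) (H : {set {set V}}) (S : {set V}) : bool :=
  #|[set e in H | S \subset e]| == 1.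

(* The default #|V| bounds every #|S|, so this is the true minimum as soon as
   the range is non-empty, i.e. for uniform H != set0 (see sparsenessP). *)
Definition sparseness (V : finType) (H : {set {set V}}) : nat :=
  \big[minn/#|V|]_(S : {set V} | in_one_edge H S) #|S|.

Definition copy (V W : finType) (f : {ffun V -> W}) (H : {set {set V}}) :
    {set {set W}} :=
  [set f @: (e : {set V}) | e in H].

Definition has_copy_with (V W : finType) (H : {set {set V}})
    (F : {set {set W}}) (e : {set W}) : bool :=
  [exists f : {ffun V -> W},
     [&& injectiveb f, copy f H \subset F & e \in copy f H]].

(* es orders the missing edges; take i.+1 es are its first i+1 entries, the
   last of which is tnth es i. *)
Definition weakly_saturated (V : finType) (r n : nat) (H : {set {set V}})
    (F : {set {set 'I_n}}) : bool :=
  (F \subset complete 'I_n r) &&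
  [exists es : #|complete 'I_n r :\: F|.-tuple {set 'I_n},
     perm_eq es (enum (complete 'I_n r :\: F)) &&
     [forall i : 'I_#|complete 'I_n r :\: F|,
        has_copy_with H (F :|: [set e in take i.+1 es]) (tnth es i)]].

(* The default 'C(n, r) is the size of the complete hypergraph, which is weakly
   saturated, so this is the true minimum (see wsatP). *)
Definition wsat (V : finType) (r n : nat) (H : {set {set V}}) : nat :=
  \big[minn/'C(n, r)]_(F : {set {set 'I_n}} | weakly_saturated r H F) #|F|.

Local Open Scope ring_scope.

Definition gamma_range (V : finType) (s : nat) (H G : {set {set V}}) : bool :=
  [&& G \subset H, G != set0 &
      (#|shadow (s - 1)%N G| < #|shadow (s - 1)%N H|)%N].

Definition gamma_ratio (V : finType) (s : nat) (H G : {set {set V}}) : rat :=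
  (#|H|%:R - #|G|%:R - 1) /
  (#|shadow (s - 1)%N H|%:R - #|shadow (s - 1)%N G|%:R).

(* Every ratio in range is at most #|H|, so the default does not affect the
   minimum when the range is non-empty, as it is when sparseness H >= 2
   (see gammaP and gamma_range_ex). *)
Definition gamma (V : finType) (s : nat) (H : {set {set V}}) : rat :=
  \big[Num.min/#|H|%:R]_(G : {set {set V}} | gamma_range s H G)
    gamma_ratio s H G.

Local Close Scope ring_scope.

Lemma bigminn_attained (I : finType) (x : nat) (P : pred I) (F : I -> nat)
    (j : I) : P j -> (forall i, P i -> F i <= x) ->
  (exists2 i, P i & \big[minn/x]_(i | P i) F i = F i) /\
  (forall i, P i -> \big[minn/x]_(i | P i) F i <= F i).
Proof.
move=> Pj le_x.
have -> : \big[minn/x]_(i | P i) F i = \big[Order.min/x]_(i | P i) F i.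
  by apply: (big_rec2 (fun a b => a = b)) => // i a b _ ->; rewrite minEnat.
split; last by move=> i Pi; rewrite -leEnat; apply: bigmin_le_cond.
have [|i Pi ->] := eq_bigmin (T := nat) (x := x) j P F Pj; last by exists i.
by move=> i Pi; rewrite leEnat le_x.
Qed.

Lemma in_one_edge_edge (V : finType) (r : nat) (H : {set {set V}}) (e : {set V}) :
  uniform r H -> e \in H -> in_one_edge H e.
Proof.
move=> /forall_inP Hr eH; apply/cards1P; exists e; apply/setP=> f.
rewrite !inE; apply/andP/eqP => [[fH sef]|->]; last by rewrite eH subxx.
by apply/esym/eqP; rewrite eqEcard sef (eqP (Hr _ eH)) (eqP (Hr _ fH)) /=.
Qed.

Lemma sparsenessP (V : finType) (r : nat) (H : {set {set V}}) :
  uniform r H -> H != set0 ->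
  (exists2 S, in_one_edge H S & sparseness H = #|S|) /\
  (forall S, in_one_edge H S -> sparseness H <= #|S|).
Proof.
move=> Hr /set0Pn[e eH].
apply: (bigminn_attained (in_one_edge_edge Hr eH)) => S _; exact: max_card.
Qed.

Lemma weakly_saturated_complete (V : finType) (r n : nat) (H : {set {set V}}) :
  weakly_saturated r H (complete 'I_n r).
Proof.
rewrite /weakly_saturated subxx /=.
have szK : size (enum (complete 'I_n r :\: complete 'I_n r)) ==
           #|complete 'I_n r :\: complete 'I_n r| by rewrite -cardE.
apply/existsP; exists (Tuple szK); rewrite perm_refl /=.
apply/forallP=> -[i i_lt]; exfalso; move: i_lt.
by rewrite setDv cards0.
Qed.

Lemma wsatP (V : finType) (r n : nat) (H : {set {set V}}) :
  (exists2 F : {set {set 'I_n}},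
     weakly_saturated r H F & wsat r n H = #|F|) /\
  (forall F : {set {set 'I_n}}, weakly_saturated r H F -> wsat r n H <= #|F|).
Proof.
apply: (bigminn_attained (weakly_saturated_complete r n H)) => F /andP[sF _].
have <- : #|complete 'I_n r| = 'C(n, r) by rewrite card_draws card_ord.
exact: subset_leq_card.
Qed.

Lemma gammaP (V : finType) (s : nat) (H G0 : {set {set V}}) :
  gamma_range s H G0 ->
  (exists2 G, gamma_range s H G & gamma s H = gamma_ratio s H G) /\
  (forall G, gamma_range s H G -> (gamma s H <= gamma_ratio s H G)%R).
Proof.
move=> rG0; split; last by move=> G rG; apply: bigmin_le_cond.
have [|G rG eG] := eq_bigmin (x := #|H|%:R%R) G0 (gamma_range s H)
  (gamma_ratio s H) rG0; last by exists G.
move=> G /and3P[sGH _ ltsh]; rewrite /gamma_ratio.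
have d1 : (1 <= #|shadow (s - 1) H|%:R - #|shadow (s - 1) G|%:R :> rat)%R.
  by rewrite -natrB 1?ltnW // (ler_nat _ 1) subn_gt0.
rewrite ler_pdivrMr; last exact: lt_le_trans ltr01 d1.
apply: (@le_trans _ _ (#|H|%:R : rat)%R).
  by rewrite -addrA gerDl -opprD oppr_le0 addr_ge0 ?ler0n.
by rewrite ler_peMr ?ler0n.
Qed.

Lemma gamma_range_ex (V : finType) (r : nat) (H : {set {set V}}) :
  uniform r H -> H != set0 -> 2 <= sparseness H ->
  exists G, gamma_range (sparseness H) H G.
Proof.
move=> Hr H0 s2; have [_ smin] := sparsenessP Hr H0.
have /set0Pn[e eH] := H0; set s := sparseness H in s2 smin *.
have He f : f \in H -> #|f| = r.
  by move: Hr => /forall_inP Hr fH; apply/eqP/Hr.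
have le_sr : s <= r by rewrite -(He e eH); apply/smin/(in_one_edge_edge Hr).
have [f fH nfe] : exists2 f, f \in H & f != e.
  apply/exists_inP; apply: contraLR s2; rewrite negb_exists_in -leqNgt.
  move=> /forall_inP Hall; apply: leq_trans (smin set0 _) _; last by rewrite cards0.
  apply/cards1P; exists e; apply/setP=> f; rewrite !inE sub0set andbT.
  by apply/idP/eqP => [/Hall/negPn/eqP|->].
have [v vf ve] : exists2 v, v \in f & v \notin e.
  by apply/subsetPn; apply: contra nfe => sfe; rewrite eqEcard sfe !He /=.
exists [set e]; apply/and3P; split; first by rewrite sub1set.
  by apply/set0Pn; exists e; rewrite set11.
apply/proper_card/properP; split.
  apply/subsetP=> S; rewrite !inE => /andP[-> /exists_inP[g]].
  by rewrite inE => /eqP-> Se; apply/exists_inP; exists e.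
have : s - 2 <= #|f :\ v|.
  by move: (cardsD1 v f); rewrite vf He // => E; lia.
case/card_geqP => t [ut szt st]; exists (v |: [set x in t]).
  rewrite inE cardsU1 inE cardsE (card_uniqP ut) szt; apply/andP; split.
    suff -> : v \notin t by apply/eqP; lia.
    by apply/negP=> /st; rewrite !inE eqxx.
  apply/exists_inP; exists f => //; rewrite subUset sub1set vf /=.
  by apply/subsetP=> x; rewrite inE => /st; rewrite !inE => /andP[].
apply/negP; rewrite inE => /andP[_ /exists_inP[g]]; rewrite inE => /eqP->.
by rewrite subUset sub1set (negbTE ve).
Qed.

(* Main.v *)
Require Import Defs.
From mathcomp Require Import all_boot all_order all_algebra.
From mathcomp Require Import perm.
From mathcomp Require Import zify lra.

Set Implicit Arguments.
Unset Strict Implicit.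
Unset Printing Implicit Defensive.

Import Order.TTheory GRing.Theory Num.Theory.

(** Writing [∂] for the [(s-1)]-shadow, put
    [b X = gamma (|∂X| - |∂H|) + |E(H)| - 1] for a set [X] of edges of [K_n]. As
    the shadow is submodular, so is [b], and the definition of [gamma] says that
    copies of [H] behave like the circuits of a count matroid: a copy [K] has
    [b K = |K| - 1], while [|G| <= b G] for its proper non-empty subsets [G].
    Call [C] dense if [b C <= |C ∩ F|], and let [P] be a family of disjoint dense
    sets that is as coarse as possible. Merging a circuit [K] with the members of
    [P] that it meets gives another dense set as soon as at most one element of
    [K] lies outside [F] and these members; by the choice of [P], such a [K] lies
    inside one member. Hence the saturation process never leaves [F ∪ cover P],
    and then every copy of [H] lies inside one member. As [s >= 2], every vertex
    of an edge of [H] lies in a second edge, which connects the edges of [K_n]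
    through copies of [H], so that one member [C] contains all of [K_n] and
    [b K_n <= b C <= |C ∩ F| <= |F|]. *)

Section DisjointFamilies.

Variable T : finType.
Implicit Types (C K X : {set T}) (P Q : {set {set T}}).

Lemma card_setI_cover X Q :
  trivIset Q -> #|X :&: cover Q| = \sum_(C in Q) #|X :&: C|.
Proof.
move=> trivQ; rewrite setIC -sum1_card.
under eq_bigl do rewrite inE.
rewrite big_mkcondr (big_trivIset _ trivQ) /=; apply: eq_bigr => C _.
rewrite -big_mkcondr -sum1_card; apply: eq_bigl => x.
by rewrite inE andbC.
Qed.

Definition touching P K := [set C in P | ~~ [disjoint C & K]].

Lemma touching_sub P K : touching P K \subset P.
Proof. by apply/subsetP => C; rewrite inE => /andP[]. Qed.

Lemma setD_cover_touching P K : K :\: cover (touching P K) = K :\: cover P.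
Proof.
apply/setP => x; rewrite !in_setD; case xK: (x \in K); last by rewrite !andbF.
congr (~~ _ && _); apply/bigcupP/bigcupP => -[C CP xC]; exists C => //.
  exact: (subsetP (touching_sub P K)).
by rewrite inE CP; apply/pred0Pn; exists x; rewrite /= xC.
Qed.

Definition merged_member P K := K :|: cover (touching P K).

Definition merge P K := merged_member P K |: (P :\: touching P K).

Lemma trivIset_merge P K : trivIset P -> trivIset (merge P K).
Proof.
move=> trivP; apply: trivIsetU (trivIset1 _) (trivIsetD _ trivP) _.
rewrite cover1; apply: bigcup_disjoint => C; rewrite !inE => /andP[+ CP].
rewrite CP negbK => disCK; rewrite -setI_eq0 setIUl setU_eq0 !setI_eq0.
rewrite disjoint_sym disCK disjoint_sym.
apply: bigcup_disjoint => D; rewrite inE => /andP[DP DK].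
by apply: (trivIsetP trivP) => //; apply: contraNneq DK => <-.
Qed.

Lemma subset_merge_member P K C :
  C \in K |: P -> exists2 D, D \in merge P K & C \subset D.
Proof.
case: (boolP (C \in touching P K)) => [CQ _ | CQ].
  exists (merged_member P K); first exact: setU11.
  by rewrite subsetU // (bigcup_sup C) ?orbT.
case/setU1P => [-> | CP].
  by exists (merged_member P K); rewrite ?setU11 ?subsetUl.
by exists C; rewrite // in_setU1 in_setD CQ CP orbT.
Qed.

Definition same_member P :=
  [set xy : T * T | [exists C in P, (xy.1 \in C) && (xy.2 \in C)]].

Lemma same_memberP P x y :
  reflect (exists C, [/\ C \in P, x \in C & y \in C])
          ((x, y) \in same_member P).
Proof.
rewrite inE; apply: (iffP exists_inP) => [[C CP /andP[xC yC]] | [C [CP xC yC]]].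
  by exists C.
by exists C; rewrite ?xC.
Qed.

Lemma same_member_merge P K : same_member P \subset same_member (merge P K).
Proof.
apply/subsetP => -[x y] /same_memberP[C [CP xC yC]].
have [D DP sCD] := subset_merge_member (setU1r K CP).
by apply/same_memberP; exists D; rewrite DP !(subsetP sCD).
Qed.

Lemma merge_stable_subset_member P K :
    trivIset P -> K != set0 ->
    same_member (merge P K) \subset same_member P ->
  exists2 C, C \in P & K \subset C.
Proof.
move=> trivP /set0Pn[x xK] /subsetP stable.
have [D DP sKD] := subset_merge_member (setU11 K P).
have with_x y : y \in K -> exists C, [/\ C \in P, x \in C & y \in C].
  move=> yK; apply/same_memberP/stable/same_memberP.
  by exists D; rewrite DP !(subsetP sKD).
have [C [CP xC _]] := with_x x xK; exists C => //; apply/subsetP => y yK.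
have [C' [C'P xC' yC']] := with_x y yK.
by rewrite -(def_pblock trivP CP xC) (def_pblock trivP C'P xC').
Qed.

End DisjointFamilies.

Section SubmodularCount.

Local Open Scope ring_scope.

Variables (R : realFieldType) (T : finType) (b : {set T} -> R).
Implicit Types (C F G K X Y : {set T}) (P Q : {set {set T}}).

Definition submodular := forall X Y, b (X :|: Y) + b (X :&: Y) <= b X + b Y.

(* For integral non-decreasing [b] these are the circuits of the matroid whose
   independent sets are those [I] with [|G| <= b G] for every non-empty subset
   [G] of [I]. *)
Definition circuit K := [/\ K != set0, b K <= #|K|%:R - 1 &
  forall G, G \proper K -> G != set0 -> #|G|%:R <= b G].

Definition dense F C := b C <= #|C :&: F|%:R.

Definition dense_family F P := trivIset P && [forall C in P, dense F C].

Hypothesis b_submod : submodular.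

Lemma submodular_cover X Q : trivIset Q ->
  b (X :|: cover Q) + \sum_(C in Q) b (X :&: C) <= b X + \sum_(C in Q) b C.
Proof.
move=> /trivIsetP trivQ; rewrite /cover -!big_enum /=.
have : {subset enum Q <= Q} by move=> C; rewrite mem_enum.
elim: (enum Q) (enum_uniq Q) => [|C t IHt] /=; first by rewrite !big_nil setU0.
case/andP => Ct uniq_t sub_tQ; rewrite !big_cons.
have {}IHt := IHt uniq_t (fun D Dt => sub_tQ D (mem_behead (s := C :: t) Dt)).
have disC : C :&: \bigcup_(D <- t) D = set0.
  apply/eqP; rewrite setI_eq0 bigcup_seq; apply: bigcup_disjoint => D Dt.
  apply: trivQ; rewrite ?sub_tQ ?mem_head ?in_cons ?Dt ?orbT //.
  by apply: contraNneq Ct => ->.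
have := b_submod (X :|: \bigcup_(D <- t) D) C.
rewrite setIC setIUr disC setU0 [C :&: X]setIC -setUA [_ :|: C]setUC.
lra.
Qed.

Lemma dense_merge F P K : dense_family F P -> circuit K ->
    {in P, forall C, ~~ (K \subset C)} ->
    (#|K :\: (F :|: cover P)| <= 1)%N ->
  dense F (merged_member P K).
Proof.
move=> /andP[trivP /forall_inP denseP] [_ bK indepK] notinP.
rewrite setUC -setDDl -setD_cover_touching; set Q := touching P K.
move=> missing_le1.
have trivQ : trivIset Q := trivIsetS (touching_sub P K) trivP.
have gain : \sum_(C in Q) b C + #|K :&: cover Q|%:R <=
    \sum_(C in Q) b (K :&: C) + #|F :&: cover Q|%:R.
  rewrite !card_setI_cover // !natr_sum -!big_split /=; apply: ler_sum => C.
  rewrite inE => /andP[CP meetC]; rewrite addrC lerD //; last first.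
    by rewrite setIC; apply: denseP.
  apply: indepK; last by rewrite setIC setI_eq0.
  by rewrite properE subsetIl subsetI subxx /= notinP.
have count : (#|K| + #|F :&: cover Q| <=
    #|K :&: cover Q| + #|(K :|: cover Q) :&: F| + 1)%N.
  rewrite -(cardsID (cover Q) K) -(cardsID (cover Q) (_ :&: F)).
  have -> : (K :|: cover Q) :&: F :&: cover Q = F :&: cover Q.
    by rewrite setIAC setIC (setIidPr (subsetUr _ _)).
  have -> : (K :|: cover Q) :&: F :\: cover Q = (K :\: cover Q) :&: F.
    by rewrite -setIDAC setDUl setDv setU0.
  by have := cardsID F (K :\: cover Q); lia.
have := submodular_cover K trivQ; rewrite /dense /merged_member -/Q.
move: count; rewrite -(ler_nat R) !natrD; lra.
Qed.

Lemma exists_absorbing_dense_family F : exists2 P, dense_family F P &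
  forall K, circuit K -> (#|K :\: (F :|: cover P)| <= 1)%N ->
    exists2 C, C \in P & K \subset C.
Proof.
have dense_family0 : dense_family F set0.
  apply/andP; split; first by apply/trivIsetP => C D; rewrite inE.
  by apply/forall_inP => C; rewrite inE.
have [P denseP coarsest] :=
  arg_maxnP (fun P => #|same_member P|) dense_family0.
exists P => // K circuitK missing_le1.
have [/exists_inP[C CP sKC] | ] := boolP [exists C in P, K \subset C].
  by exists C.
rewrite negb_exists_in => /forall_inP notinP.
have [trivP /forall_inP dense_member] := andP denseP.
have [K_neq0 _ _] := circuitK; apply: (merge_stable_subset_member trivP K_neq0).
suff : same_member P == same_member (merge P K) by move/eqP <-.
rewrite eqEcard same_member_merge; apply: coarsest.
rewrite /dense_family trivIset_merge //=; apply/forall_inP => C.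
by case/setU1P => [-> | /setDP[/dense_member]] //; apply: dense_merge.
Qed.

End SubmodularCount.

Section Shadow.

Variable m : nat.

Lemma shadowS (V : finType) (X Y : {set {set V}}) :
  X \subset Y -> shadow m X \subset shadow m Y.
Proof.
move=> sXY; apply/subsetP => S; rewrite !inE => /andP[-> /exists_inP[e eX Se]].
by apply/exists_inP; exists e => //; apply: (subsetP sXY).
Qed.

Lemma shadowU (V : finType) (X Y : {set {set V}}) :
  shadow m (X :|: Y) = shadow m X :|: shadow m Y.
Proof.
apply/eqP; rewrite eqEsubset subUset !shadowS ?subsetUl ?subsetUr // !andbT.
apply/subsetP => S; rewrite !inE => /andP[-> /exists_inP[e]]; rewrite inE.
by case/orP=> eX Se; apply/orP; [left|right]; apply/exists_inP; exists e.
Qed.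

Lemma card_shadow_submod (V : finType) (X Y : {set {set V}}) :
  #|shadow m (X :|: Y)| + #|shadow m (X :&: Y)| <=
    #|shadow m X| + #|shadow m Y|.
Proof.
rewrite shadowU -[leqRHS]cardsUI leq_add2l; apply: subset_leq_card.
by rewrite subsetI !shadowS ?subsetIl ?subsetIr.
Qed.

Lemma shadow_complete (V : finType) r :
  m <= r <= #|V| -> shadow m (complete V r) = complete V m.
Proof.
move=> /andP[le_mr le_rV]; apply/setP => S; rewrite !inE.
have [/eqP cardS|//] := boolP (#|S| == m); apply/exists_inP.
have : 0 < #|[set A : {set V} | A \subset ~: S & #|A| == r - m]|.
  by rewrite cards_draws bin_gt0; have := cardsC S; lia.
case/card_gt0P => A; rewrite inE -disjoints_subset => /andP[disAS /eqP cardA].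
exists (S :|: A); last exact: subsetUl.
rewrite inE cardsU setIC (disjoint_setI0 disAS) cards0 cardS cardA subn0.
by rewrite subnKC.
Qed.

End Shadow.

Lemma subset_imset_ex (aT rT : finType) (f : aT -> rT) (A : {set rT})
    (B : {set aT}) :
  A \subset f @: B -> exists2 A' : {set aT}, A' \subset B & A = f @: A'.
Proof.
move=> sAfB; exists [set x in B | f x \in A].
  by apply/subsetP => x /setIdP[].
apply/setP => y; apply/idP/imsetP => [yA | [x + ->]]; last first.
  by rewrite !inE => /andP[].
have /imsetP[x xB yfx] := subsetP sAfB y yA.
by exists x; rewrite // inE xB -yfx.
Qed.

Section Copies.

Variables (V W : finType).
Implicit Types (f : {ffun V -> W}) (G H : {set {set V}}).

Lemma card_copy f G : injective f -> #|copy f G| = #|G|.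
Proof. by move=> f_inj; rewrite card_imset //; apply: imset_inj. Qed.

Lemma mem_copy f G (e : {set V}) : e \in G -> f @: e \in copy f G.
Proof. by move=> eG; apply/imsetP; exists e. Qed.

Lemma copy_complete r f H :
  uniform r H -> injective f -> copy f H \subset complete W r.
Proof.
move=> /forall_inP Hr f_inj; apply/subsetP => _ /imsetP[e eH ->].
by rewrite inE card_imset // Hr.
Qed.

Lemma shadow_copy m f G :
  injective f -> shadow m (copy f G) = copy f (shadow m G).
Proof.
move=> f_inj; apply/setP => S; apply/idP/imsetP.
  rewrite inE => /andP[cardS /exists_inP[_ /imsetP[e eG ->]]].
  case/subset_imset_ex => A sAe SA; exists A => //.
  rewrite inE -(card_imset _ f_inj) -SA cardS.
  by apply/exists_inP; exists e.
case=> A; rewrite inE => /andP[cardA /exists_inP[e eG sAe]] ->.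
rewrite inE card_imset // cardA; apply/exists_inP.
by exists (f @: e); [apply: mem_copy | apply: imsetS].
Qed.

End Copies.

Lemma sparseness_le (V : finType) (H : {set {set V}}) (S : {set V}) :
  in_one_edge H S -> sparseness H <= #|S|.
Proof.
move=> oneS.
by have [_ ->] := bigminn_attained oneS (fun A _ => max_card (mem A)).
Qed.

Lemma second_edge (V : finType) (H : {set {set V}}) (S e : {set V}) :
    #|S| < sparseness H -> e \in H -> S \subset e ->
  exists2 f, f \in H :\ e & S \subset f.
Proof.
move=> ltS eH Se; have : ~~ in_one_edge H S.
  by apply: contraL ltS => /sparseness_le; rewrite leqNgt.
have eHS : e \in [set f in H | S \subset f] by rewrite inE eH.
rewrite /in_one_edge (cardsD1 e) eHS -lt0n => /card_gt0P[f].
by rewrite !inE => /and3P[nfe fH Sf]; exists f; rewrite // !inE nfe.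
Qed.

Section Connectivity.

Variable W : finType.

Lemma imset_tperm_id (u v : W) (A : {set W}) :
  (u \in A) = (v \in A) -> tperm u v @: A = A.
Proof.
move=> uv; apply/eqP; rewrite eqEcard (card_imset _ perm_inj) leqnn andbT.
apply/subsetP => _ /imsetP[x xA ->].
by case: tpermP => [xu|xv|//]; [rewrite -uv -xu|rewrite uv -xv].
Qed.

Lemma exchange_ind (P : {set W} -> Prop) (A B : {set W}) :
    (forall (A' : {set W}) u v,
       u \in A' -> v \notin A' -> P A' -> P (tperm u v @: A')) ->
  #|A| = #|B| -> P A -> P B.
Proof.
move=> exchangeP; have [k] := ubnP #|A :\: B|.
elim: k A => // k IHk A lt_k cardA PA.
have [sAB | /subsetPn[u uA uB]] := boolP (A \subset B).
  suff <- : A = B by [].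
  by apply/eqP; rewrite eqEcard sAB cardA /=.
have [v vB vA] : exists2 v, v \in B & v \notin A.
  apply/subsetPn; apply: contra uB => sBA.
  suff -> : B = A by [].
  by apply/eqP; rewrite eqEcard sBA cardA /=.
apply: (IHk (tperm u v @: A)); last exact: exchangeP.
- apply: leq_trans (lt_k : #|A :\: B| <= k).
  apply/proper_card/properP; split; last first.
    exists u; rewrite inE uB //=; apply: contra vA => /imsetP[x xA].
    by move/(canLR (tpermK u v)); rewrite tpermL => ->.
  apply/subsetP => w; rewrite !inE => /andP[wB /imsetP[x xA wE]].
  by rewrite wB; move: wB; rewrite wE; case: tpermP => // _; rewrite vB.
- by rewrite card_imset //; apply: perm_inj.
Qed.

Variables (V : finType) (r : nat) (H : {set {set V}}) (C : {set {set W}}).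

Definition copy_closed := forall g : {ffun V -> W}, injective g ->
  {in H &, forall e f : {set V}, g @: e \in C -> g @: f \in C}.

Hypothesis H_uniform : uniform r H.
Hypothesis H_sparse : 2 <= sparseness H.
Hypothesis C_closed : copy_closed.

Definition swap_values (u v : W) (g : {ffun V -> W}) : {ffun V -> W} :=
  [ffun x => tperm u v (g x)].

Lemma swap_values_inj u v (g : {ffun V -> W}) :
  injective g -> injective (swap_values u v g).
Proof. by move=> g_inj x y; rewrite !ffunE => /perm_inj/g_inj. Qed.

Lemma imset_swap_values u v (g : {ffun V -> W}) (e : {set V}) :
  swap_values u v g @: e = tperm u v @: (g @: e).
Proof. by rewrite -imset_comp; apply: eq_imset => x; rewrite ffunE. Qed.

(* A second edge [f] through [g^-1 u] is used as a bridge: once [v] has been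
   moved into [g f], the transposition fixes [g f] but moves [g e]. *)
Lemma copy_closed_tperm (g : {ffun V -> W}) (e : {set V}) (u v : W) :
    injective g -> e \in H -> u \in g @: e -> v \notin g @: e ->
  g @: e \in C -> tperm u v @: (g @: e) \in C.
Proof.
move=> g_inj eH /imsetP[z ze ->] ve eC.
have [f /setD1P[nfe fH] zf] : exists2 f, f \in H :\ e & [set z] \subset f.
  by apply: second_edge; rewrite ?cards1 ?sub1set.
rewrite sub1set in zf.
have [y yf ye] : exists2 y, y \in f & y \notin e.
  apply/subsetPn; apply: contra nfe => sfe.
  have /forall_inP Hr := H_uniform.
  by rewrite eqEcard sfe (eqP (Hr _ eH)) (eqP (Hr _ fH)) /=.
pose g' := swap_values v (g y) g.
have g'_inj : injective g' := swap_values_inj g_inj.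
have g'e : g' @: e = g @: e.
  rewrite imset_swap_values imset_tperm_id // (negbTE ve).
  by rewrite mem_imset // (negbTE ye).
have g'z : g' z = g z.
  rewrite ffunE tpermD //; first by apply: contraNneq ve => ->; apply: imset_f.
  by apply: contraNneq ye => /g_inj ->.
have g'y : g' y = v by rewrite ffunE tpermR.
have fC : g' @: f \in C by apply: (C_closed g'_inj eH fH); rewrite g'e.
rewrite -g'e -imset_swap_values.
apply: (C_closed (swap_values_inj g'_inj) fH eH).
by rewrite imset_swap_values imset_tperm_id // -g'z -g'y !imset_f.
Qed.

Lemma copy_closed_complete (g : {ffun V -> W}) (e : {set V}) :
  injective g -> e \in H -> g @: e \in C -> complete W r \subset C.
Proof.
move=> g_inj eH eC; apply/subsetP => B; rewrite inE => /eqP cardB.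
have /forall_inP/(_ e eH)/eqP card_e := H_uniform.
pose copy_in_C A :=
  exists h : {ffun V -> W}, [/\ injective h, A = h @: e & h @: e \in C].
suff [h [_ -> //]] : copy_in_C B.
apply: (exchange_ind (A := g @: e)); last by exists g.
  move=> A u v uA vA [h [h_inj AE hC]]; rewrite AE in uA vA *.
  exists (swap_values u v h); rewrite imset_swap_values.
  by split=> //; [apply: swap_values_inj | apply: copy_closed_tperm].
by rewrite card_imset // card_e cardB.
Qed.

End Connectivity.

Section WeakSaturation.

Variables (V : finType) (r n : nat) (H : {set {set V}}).

Lemma weakly_saturated_complete_sub (F X : {set {set 'I_n}}) :
    weakly_saturated r H F -> F \subset X ->
    (forall g : {ffun V -> 'I_n}, injective g ->
       #|copy g H :\: X| <= 1 -> copy g H \subset X) ->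
  complete 'I_n r \subset X.
Proof.
move=> /andP[_ /existsP[es /andP[es_perm /forallP es_copy]]] sFX absorb.
suff added i : i <= size es -> [set e in take i es] \subset X.
  apply/subsetP => e e_r; have [eF|eF] := boolP (e \in F).
    exact: (subsetP sFX).
  apply: (subsetP (added (size es) (leqnn _))).
  by rewrite inE take_size (perm_mem es_perm) mem_enum in_setD eF.
elim: i => [_ | i IHi lt_i].
  by apply/subsetP => e; rewrite take0 inE.
have lt_iM : i < #|complete 'I_n r :\: F| by rewrite -(size_tuple es).
have /existsP[g /and3P[/injectiveP g_inj sK e_K]] := es_copy (Ordinal lt_iM).
set e := tnth es _ in sK e_K.
have takeS : [set x in take i.+1 es] = e |: [set x in take i es].
  apply/setP => x; rewrite !inE (take_nth e) // mem_rcons in_cons.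
  by rewrite -(tnth_nth e es (Ordinal lt_iM)).
rewrite takeS subUset IHi 1?ltnW // sub1set andbT.
apply: (subsetP (absorb g g_inj _)) => //.
rewrite -(cards1 e); apply/subset_leq_card; rewrite subDset.
apply: subset_trans sK _; rewrite takeS setUCA setUC setSU //.
by rewrite subUset sFX IHi // ltnW.
Qed.

Variable R : realFieldType.

Lemma submodular_le_wsat (b : {set {set 'I_n}} -> R) :
    uniform r H -> H != set0 -> 2 <= sparseness H -> #|V| <= n ->
    submodular b -> {homo b : X Y / X \subset Y >-> (X <= Y)%R} ->
    (forall g : {ffun V -> 'I_n}, injective g -> circuit b (copy g H)) ->
  (b (complete 'I_n r) <= (wsat r n H)%:R)%R.
Proof.
move=> Hr /set0Pn[e eH] H_sparse le_Vn b_submod b_homo circuit_copy.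
have [[F satF ->] _] := wsatP r n H.
have [P /andP[trivP /forall_inP denseP] absorb] :=
  exists_absorbing_dense_family b_submod F.
have coverF : complete 'I_n r \subset F :|: cover P.
  apply: weakly_saturated_complete_sub satF (subsetUl _ _) _ => g g_inj.
  case/(absorb _ (circuit_copy g g_inj)) => C CP sKC.
  exact: subset_trans sKC (subset_trans (bigcup_sup C CP) (subsetUr F _)).
have copy_in (g : {ffun V -> 'I_n}) :
    injective g -> exists2 C, C \in P & copy g H \subset C.
  move=> g_inj; apply: absorb (circuit_copy g g_inj) _.
  rewrite (_ : _ :\: _ = set0) ?cards0 //; apply/eqP; rewrite setD_eq0.
  exact: subset_trans (copy_complete Hr g_inj) coverF.
pose g_incl := [ffun x : V => widen_ord le_Vn (enum_rank x)].
have g_incl_inj : injective g_incl.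
  by move=> x y; rewrite !ffunE => -[] /val_inj/enum_rank_inj.
have [C CP sub_inclC] := copy_in g_incl g_incl_inj.
have closedC : copy_closed H C.
  move=> g /copy_in[D DP /subsetP sgD] e1 e2 e1H e2H e1C.
  have e1D : g @: e1 \in D by apply/sgD/mem_copy.
  rewrite -(def_pblock trivP CP e1C) (def_pblock trivP DP e1D).
  exact/sgD/mem_copy.
have completeC : complete 'I_n r \subset C.
  apply: (copy_closed_complete Hr H_sparse closedC g_incl_inj eH).
  exact/(subsetP sub_inclC)/mem_copy.
apply: le_trans (b_homo _ _ completeC) (le_trans (denseP C CP) _).
by rewrite ler_nat subset_leq_card ?subsetIr.
Qed.

End WeakSaturation.

Section ShadowRank.

Local Open Scope ring_scope.

Variables (V : finType) (s : nat) (H : {set {set V}}).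

Lemma gamma_ge0 : 0 <= gamma s H.
Proof.
apply: le_bigmin => // G /and3P[sGH _ ltsh]; apply: divr_ge0.
  rewrite -addrA -opprD subr_ge0 natr1 ler_nat proper_card // properEneq sGH.
  by rewrite andbT; apply: contraTneq ltsh => ->; rewrite ltnn.
by rewrite subr_ge0 ler_nat ltnW.
Qed.

Definition shadow_rank (W : finType) (X : {set {set W}}) : rat :=
  gamma s H * (#|shadow (s - 1) X|%:R - #|shadow (s - 1) H|%:R) + #|H|%:R - 1.

Lemma shadow_rank_homo (W : finType) :
  {homo @shadow_rank W : X Y / X \subset Y >-> X <= Y}.
Proof.
move=> X Y sXY; rewrite !lerD2r ler_wpM2l ?gamma_ge0 // lerD2r ler_nat.
exact/subset_leq_card/shadowS.
Qed.

Lemma shadow_rank_submodular (W : finType) : submodular (@shadow_rank W).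
Proof.
move=> X Y; have := card_shadow_submod (s - 1) X Y.
rewrite -(ler_nat rat) !natrD => /(ler_wpM2l gamma_ge0).
by rewrite /shadow_rank !mulrDr; lra.
Qed.

Lemma shadow_rank_copy (W : finType) (f : {ffun V -> W}) (G : {set {set V}}) :
  injective f -> shadow_rank (copy f G) = shadow_rank G.
Proof. by move=> f_inj; rewrite /shadow_rank shadow_copy // card_copy. Qed.

Lemma card_le_shadow_rank (G : {set {set V}}) :
  G \proper H -> G != set0 -> #|G|%:R <= shadow_rank G.
Proof.
move=> pGH G_neq0; rewrite /shadow_rank.
have ltGH : #|G|%:R + 1 <= #|H|%:R :> rat by rewrite natr1 ler_nat proper_card.
have := subset_leq_card (shadowS (s - 1) (proper_sub pGH)).
rewrite leq_eqVlt => /predU1P[-> | ltsh]; first by rewrite subrr mulr0; lra.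
have rangeG : gamma_range s H G by rewrite /gamma_range proper_sub ?G_neq0.
have [_ /(_ G rangeG)] := gammaP rangeG.
rewrite /gamma_ratio ler_pdivlMr ?subr_gt0 ?ltr_nat // !mulrBr; lra.
Qed.

Lemma shadow_rank_circuit (W : finType) (f : {ffun V -> W}) :
  H != set0 -> injective f -> circuit (@shadow_rank W) (copy f H).
Proof.
move=> H_neq0 f_inj; split; first by rewrite -card_gt0 card_copy // card_gt0.
  by rewrite shadow_rank_copy // card_copy // /shadow_rank subrr mulr0 add0r.
move=> _ /[dup] /proper_sub/subset_imset_ex[G sGH ->] pGH G_neq0.
rewrite -/(copy f G) shadow_rank_copy // card_copy //.
apply: card_le_shadow_rank.
  by rewrite properEcard sGH; have := proper_card pGH; rewrite !card_copy.
by apply: contraNneq G_neq0 => ->; rewrite imset0.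
Qed.

End ShadowRank.

Theorem theorem5p2 (r s : nat) (hr : (2 <= r)%N) (hs : (2 <= s)%N)
    (V : finType) (H : {set {set V}}) (H_uniform : uniform r H)
    (H_nonempty : H != set0) (H_sparseness : sparseness H = s)
    (n : nat) (hn : (#|V| <= n)%N) :
  ((wsat r n H)%:R >=
     gamma s H * ('C(n, (s - 1)%N)%:R - #|shadow (s - 1)%N H|%:R)
     + #|H|%:R - 1 :> rat)%R.
Proof.
have [e eH] := set0Pn _ H_nonempty.
have card_e : #|e| = r by have /forall_inP/(_ e eH)/eqP := H_uniform.
have le_sr : s <= r.
  rewrite -H_sparseness -card_e.
  exact/sparseness_le/(in_one_edge_edge H_uniform).
have le_rn : r <= n by rewrite -card_e (leq_trans (max_card _)).
have card_shadow_Kn : #|shadow (s - 1) (complete 'I_n r)| = 'C(n, s - 1).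
  rewrite shadow_complete ?card_draws ?card_ord // le_rn andbT.
  exact: leq_trans (leq_subr _ _) le_sr.
rewrite -card_shadow_Kn.
apply: (submodular_le_wsat (b := @shadow_rank V s H 'I_n)) => //.
- by rewrite H_sparseness.
- exact: shadow_rank_submodular.
- exact: shadow_rank_homo.
- by move=> g; apply: shadow_rank_circuit.
Qed.
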